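(* Let $f\colon\mathcal{E}\to\overline{\mathbb{R}}_{++}$ be upper semicontinuous and strictly upper radial, let $x^*,y^*\in\mathcal{E}$ satisfy $(y^*,f^\Gamma(y^* ))=\Gamma(x^*,f(x^* ))$, and suppose that for some $C>0$ $$f(x)\le\left(f(x^* )-C\|x-x^*\|\right)_+\qquad\text{for all }x\in\mathcal{E}.$$ Then $$f^\Gamma(y)\ge f^\Gamma(y^* )+\frac{C}{C\|x^*\|+f(x^* )}\,\|y-y^*\|\qquad\text{for all }y\in\mathcal{E}.$$
   Context: $\mathcal{E}$ is a finite-dimensional Euclidean space with norm $\|\cdot\|$, $\overline{\mathbb{R}}_{++}=\mathbb{R}_{++}\cup\{0,+\infty\}$, and $(t)_+=\max\{t,0\}$. For $f\colon\mathcal{E}\to\overline{\mathbb{R}}_{++}$: $\mathrm{epi}\,f=\{(x,u)\in\mathcal{E}\times\mathbb{R}_{++}: f(x)\le u\}$ and $\mathrm{hypo}\,f=\{(x,u)\in\mathcal{E}\times\mathbb{R}_{++}: f(x)\ge u\}$; $f$ is upper semicontinuous if $\mathrm{hypo}\,f$ is closed relative to $\mathcal{E}\times\mathbb{R}_{++}$. The function $f$ is upper radial if for every $y$ the function $v\mapsto v\cdot f(y/v)$ is upper semicontinuous and nondecreasing on $\mathbb{R}_{++}$; it is strictly upper radial if moreover this function is strictly increasing in $v$ wherever $v\cdot f(y/v)\in\mathbb{R}_{++}$. With $\Gamma(x,u)=(x,1)/u$ for $u\in\mathbb{R}_{++}$ (so the hypothesis on $x^*,y^*$ includes $f(x^*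 )\in\mathbb{R}_{++}$), the radial dual is $f^\Gamma(y)=\sup\{v>0: (y,v)\in\Gamma(\mathrm{epi}\,f)\}=\sup\{v>0: v\cdot f(y/v)\le 1\}$, with $\sup\emptyset=0$. *)

(* Defs.v *)
From HB Require Import structures.
From mathcomp Require Import all_boot all_order all_algebra.
From mathcomp Require Import all_classical all_reals all_analysis.

Set Implicit Arguments.
Unset Strict Implicit.
Unset Printing Implicit Defensive.

Import Order.TTheory GRing.Theory Num.Theory numFieldNormedType.Exports.

Local Open Scope classical_set_scope.
Local Open Scope ring_scope.

(* Finite-dimensional Euclidean spaces: a vectType (finite dimension) whose
   norm, and hence whose topology, comes from an inner product. *)
HB.mixin Record isEuclidean (R : realType) (E : Type)
    of NormedModule R E & Vector R E := {
  inner : {dot E for idfun};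
  norm_inner : forall x : E, `|x| = Num.sqrt (inner x x)
}.

#[short(type="euclideanType")]
HB.structure Definition Euclidean (R : realType) :=
  { E of isEuclidean R E & NormedModule R E & Vector R E }.

Definition Rpp {R : realType} : set R := [set u | 0 < u].

Section Semicontinuity.
Context {R : realType}.

(* D need not be closed in T. *)
Definition relatively_closed {T : topologicalType} (D A : set T) : Prop :=
  exists2 F : set T, closed F & A = F `&` D.

(* Functions with values in R_++ `|` {0, +oo} are maps g into \bar R with
   0 <= g.  The domain D covers both f on E (D = setT) and v |-> v * f (y / v)
   on R_++. *)
Definition hypo {T : Type} (D : set T) (g : T -> \bar R) : set (T * R) :=
  [set p | [/\ D p.1, Rpp p.2 & (p.2%:E <= g p.1)%E]].

Definition upper_semicontinuous_on {T : topologicalType}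
    (D : set T) (g : T -> \bar R) : Prop :=
  relatively_closed (D `*` Rpp) (hypo D g).

End Semicontinuity.

Section RadialDuality.
Context {R : realType} {E : euclideanType R}.
Implicit Types (f : E -> \bar R) (y : E).

Definition epi f : set (E * R) :=
  [set p | Rpp p.2 /\ (f p.1 <= p.2%:E)%E].

(* Only meaningful for p.2 > 0. *)
Definition Gamma (p : E * R) : E * R := (p.2^-1 *: p.1, p.2^-1).

Definition persp f y (v : R) : \bar R := (v%:E * f (v^-1 *: y))%E.

Definition upper_radial f : Prop :=
  forall y, upper_semicontinuous_on Rpp (persp f y) /\
    (forall v w, 0 < v -> v <= w -> (persp f y v <= persp f y w)%E).

Definition strictly_upper_radial f : Prop :=
  upper_radial f /\
  forall y v w, 0 < v -> v < w ->
    (0 < persp f y v < +oo)%E -> (0 < persp f y w < +oo)%E ->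
    (persp f y v < persp f y w)%E.

(* The point 0 is adjoined because ereal_sup set0 = -oo, whereas the convention
   here is sup set0 = 0; all other elements are positive. *)
Definition radial_dual f y : \bar R :=
  ereal_sup (0%E |` [set v%:E | v in [set v | 0 < v /\ (Gamma @` epi f) (y, v)]]).

End RadialDuality.

(* Main.v *)
(* The point w := v + d, with d := C |y - ystar| / (C |xstar| + u), satisfies
   w f(y/w) <= 1 and so competes in the supremum defining the dual at y.
   Indeed ystar = v xstar and v u = 1, so y - w xstar = (y - ystar) - d xstar,
   and the growth bound scaled by w becomes
     w u - C |y - w xstar| <= 1 + d u - C |y - ystar| + C d |xstar| = 1;
   the last equality is what dictates the constant C / (C |xstar| + u). *)
Require Import Defs.
From mathcomp Require Import all_boot all_order all_algebra.
From mathcomp Require Import all_classical all_reals all_analysis.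
From mathcomp Require Import lra.

Import Order.TTheory GRing.Theory Num.Theory numFieldNormedType.Exports.

Local Open Scope classical_set_scope.
Local Open Scope ring_scope.

Theorem proposition4 (R : realType) (E : euclideanType R)
    (f : E -> \bar R) (xstar ystar : E) (u v C : R)
    (f_ge0 : forall x, (0 <= f x)%E)
    (f_usc : upper_semicontinuous_on setT f)
    (f_sur : strictly_upper_radial f)
    (u_gt0 : 0 < u)
    (f_xstar : f xstar = u%:E)
    (dual_ystar : radial_dual f ystar = v%:E)
    (Gamma_xstar : (ystar, v) = Gamma (xstar, u))
    (C_gt0 : 0 < C)
    (f_growth : forall x,
      (f x <= Order.max (f xstar - (C * `|x - xstar|)%:E) 0)%E) :
  forall y : E,
    (radial_dual f ystar + (C / (C * `|xstar| + u) * `|y - ystar|)%:E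
       <= radial_dual f y)%E.
Proof.
case: Gamma_xstar => ystarE vE y.
have v_gt0 : 0 < v by rewrite vE invr_gt0.
have vu1 : v * u = 1 by rewrite vE mulVf ?gt_eqF.
have ystar_v : ystar = v *: xstar by rewrite ystarE vE.
have K_gt0 : 0 < C * `|xstar| + u by rewrite ltr_wpDl ?mulr_ge0 // ltW.
set d := C / (C * `|xstar| + u) * `|y - ystar|.
have d_ge0 : 0 <= d by rewrite !mulr_ge0 ?invr_ge0 // ltW.
have dK : d * (C * `|xstar| + u) = C * `|y - ystar|.
  by rewrite /d mulrAC divfK ?gt_eqF.
have w_gt0 : 0 < v + d by rewrite ltr_wpDr.
set w := v + d in w_gt0 *.
rewrite dual_ystar -EFinD; apply: ereal_sup_ubound; right; exists w => //.
(* [Gamma] is an involution at positive heights, so the preimage of [(y, w)] is [Gamma (y, w)]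
   itself. *)
split=> //; exists (w^-1 *: y, w^-1); last first.
  by rewrite /Gamma /= invrK scalerA mulfV ?scale1r ?gt_eqF.
split; first by rewrite /Rpp /= invr_gt0.
apply: le_trans (f_growth _) _.
(* The 0 branch of the maximum is harmless, [w^-1] being positive; the affine branch remains. *)
rewrite f_xstar -EFinB ge_max !lee_fin invr_ge0 (ltW w_gt0) andbT.
rewrite -(ler_pM2l w_gt0) mulfV ?gt_eqF // mulrBr mulrCA.
have -> : w * `|w^-1 *: y - xstar| = `|y - w *: xstar|.
  rewrite -[X in X * _](gtr0_norm w_gt0) -normrZ scalerBr scalerA.
  by rewrite mulfV ?scale1r ?gt_eqF.
have dist_ge : `|y - ystar| - d * `|xstar| <= `|y - w *: xstar|.
  rewrite -[X in X * _](ger0_norm d_ge0) -normrZ.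
  have -> : y - w *: xstar = (y - ystar) - d *: xstar.
    by rewrite ystar_v /w scalerDl opprD addrA.
  exact: lerB_dist.
have := ler_wpM2l (ltW C_gt0) dist_ge.
(* In [(v + d) * u], [vu1] turns [v * u] into 1; by [dK] the terms in [d] cancel against
   [C |y - ystar|]. *)
rewrite /w; nra.
Qed.
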